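(* Let $M$ be a dense linear subspace of an extended locally convex space $(X,\tau)$. If $M$ is a barreled subspace of $(X,\tau)$, then $(X,\tau)$ is also barreled.
   Context: Vector spaces are over $\mathbb{K}\in\{\mathbb{R},\mathbb{C}\}$. An extended seminorm on a vector space $X$ is a map $\rho:X\to[0,\infty]$ with $\rho(\alpha x)=|\alpha|\rho(x)$ (convention $0\cdot\infty=0$) and $\rho(x+y)\le\rho(x)+\rho(y)$. An extended locally convex space (elcs) is a vector space $X$ with a Hausdorff topology $\tau$ induced by a family $\mathcal{P}$ of extended seminorms, i.e. the sets $\{y\in X:\rho(y-x)<\epsilon\}$ ($\rho\in\mathcal{P}$, $x\in X$, $\epsilon>0$) form a subbase of $\tau$. A barrel in an elcs is a closed, absolutely convex (balanced and convex), absorbing subset; an elcs is barreled if every barrel in it is a neighborhood of $0$. A subspace $M$ of an elcs $(X,\tau)$ is a barreled subspace if $(M,\tau|_M)$ is barreled, where $\tau|_M$ is the subspace topology. *)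

(* Defs.v *)
From HB Require Import structures.
From mathcomp Require Import all_boot all_order all_algebra.
From mathcomp Require Import boolp classical_sets functions filter reals ereal.
From mathcomp Require Import interval_inference convex topology tvs.
From mathcomp Require Import complex.

Set Implicit Arguments.
Unset Strict Implicit.
Unset Printing Implicit Defensive.

Import Order.TTheory GRing.Theory Num.Theory.

Local Open Scope classical_set_scope.
Local Open Scope ring_scope.

Definition real_or_complex (R : realType) (K : numFieldType) : Prop :=
  K = R :> numFieldType \/ K = R[i] :> numFieldType.

(* As for norms in MathComp, values are taken in the scalar field itself. For  *)
(* K = R[i], 0 <= x in \bar K holds exactly when x is +oo or a nonnegative     *)
(* real, so the first conjunct says that rho takes its values in [0, +oo].     *)
Definition extended_seminorm (K : numFieldType) (X : lmodType K)
    (rho : X -> \bar K) : Prop :=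
  [/\ forall x, (0 <= rho x)%E,
      forall (a : K) (x : X), rho (a *: x) = (`|a|%:E * rho x)%E &
      forall x y : X, (rho (x + y)%R <= rho x + rho y)%E].

Definition seminorm_balls (K : numFieldType) (X : lmodType K)
    (P : set (X -> \bar K)) : set (set X) :=
  [set U | exists rho x (e : K),
    [/\ P rho, 0 < e & U = [set y | (rho (y - x)%R < e%:E)%E]]].

Definition subbase (T : topologicalType) (S : set (set T)) : Prop :=
  basis (finI_from S id).

(* preTopologicalLmodType imposes no compatibility between the topology and    *)
(* the vector space structure: in an extended locally convex space,            *)
(* scaling need not be continuous.                                             *)
Definition elcs (K : numFieldType) (X : preTopologicalLmodType K) : Prop :=
  hausdorff_space X /\
  exists2 P : set (X -> \bar K),
    (forall rho, P rho -> extended_seminorm rho) & subbase (seminorm_balls P).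

Definition balanced (K : numFieldType) (X : lmodType K) (A : set X) : Prop :=
  forall a : K, `|a| <= 1 -> [set a *: x | x in A] `<=` A.

Definition absolutely_convex (K : numFieldType) (X : lmodType K)
    (A : set X) : Prop :=
  balanced A /\ convex_set A.

Definition absorbing (K : numFieldType) (X : lmodType K) (A : set X) : Prop :=
  forall x : X, exists2 r : K, 0 < r &
    forall a : K, r <= `|a| -> [set a *: y | y in A] x.

Definition barrel (K : numFieldType) (X : preTopologicalLmodType K)
    (B : set X) : Prop :=
  [/\ closed B, absolutely_convex B & absorbing B].

Definition barreled (K : numFieldType) (X : preTopologicalLmodType K) : Prop :=
  forall B : set X, barrel B -> nbhs (0 : X) B.

(* The linear subspace M as a vector space of its own, with the subspace       *)
(* topology. Neither `subspace` (whose carrier is the whole space) nor         *)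
(* `set_type` (which is not an lmodType) provides both.                        *)
Definition linear_subspace (K : numFieldType) (X : preTopologicalLmodType K)
  (M : submodClosed X) : Type := {x : X | x \in M}.

Section linear_subspace_instances.
Context (K : numFieldType) (X : preTopologicalLmodType K) (M : submodClosed X).

HB.instance Definition _ := SubType.on (linear_subspace M).
HB.instance Definition _ := [Choice of linear_subspace M by <:].
HB.instance Definition _ :=
  [SubChoice_isSubLmodule of linear_subspace M by <:].
HB.instance Definition _ := Topological.copy (linear_subspace M)
  (initial_topology (val : linear_subspace M -> X)).

End linear_subspace_instances.

(* Main.v *)
Require Import Defs.
From mathcomp Require Import all_boot all_order all_algebra.
From mathcomp Require Import classical_sets reals topology tvs.

Import Order.TTheory GRing.Theory Num.Theory.

Local Open Scope classical_set_scope.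
Local Open Scope ring_scope.

(** The trace on [M] of a barrel [B] is a barrel of [M], hence contains the trace of an open [U]
    around 0. As [M] is dense, [U] lies in the closure of its trace, and so in the closed set
    [B]. *)

Lemma open_dense_sub_closed (T : topologicalType) (D U B : set T) :
  dense D -> open U -> closed B -> U `&` D `<=` B -> U `<=` B.
Proof.
move=> denseD oU clB UDB x Ux; apply: clB => V.
rewrite nbhsE => -[W [oW Wx] WV].
(* Density is applied to the intersection with [U], not to [W] alone, so that the point found also
   lies in [B]. *)
have [|y [[Uy Wy] Dy]] := denseD (U `&` W) _ (openI oU oW).
  by exists x.
by exists y; split; [apply: UDB | apply: WV].
Qed.

Lemma barrel_linear_subspace (K : numFieldType) (X : preTopologicalLmodType K)
    (M : submodClosed X) (B : set X) :
  barrel B -> barrel ((val : linear_subspace M -> X) @^-1` B).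
Proof.
move=> [clB [balB convB] absB]; split; first 1 last.
- split.
  + move=> a a1 _ [x Bx <-].
    by apply: (balB a a1); exists (val x).
  + move=> x y p; rewrite !inE => /mem_set Bx /mem_set By.
    by apply: set_mem; exact: (convB (val x) (val y) p Bx By).
- move=> x; have [r r0 rB] := absB (val x).
  exists r => // a ra; have [y By ayx] := rB a ra.
  (* [y] is only known to lie in [X]; being [x] divided by [a], it belongs to [M]. *)
  have a0 : a != 0 by rewrite -normr_gt0 (lt_le_trans r0).
  exists (a^-1 *: x); last by rewrite scalerKV.
  by move: By; rewrite -[y](scalerK a0) ayx.
- by apply: preimage_closed clB => x _; exact: initial_continuous.
Qed.

Theorem theorem3p19 (R : realType) (K : numFieldType)
    (KRC : real_or_complex R K) (X : preTopologicalLmodType K)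
    (Xelcs : elcs X) (M : submodClosed X) (Mdense : dense [set` M])
    (Mbarreled : barreled (linear_subspace M)) :
  barreled X.
Proof.
move=> B barrelB; have [clB _ _] := barrelB.
have := Mbarreled _ (barrel_linear_subspace _ _ M _ barrelB).
(* Open sets of [M] are traces of open sets of [X], which yields [U]. *)
rewrite nbhsE => -[_ [[U oU <-] U0] UB].
rewrite nbhsE; exists U; first by split=> //; move: U0; rewrite /= linear0.
apply: (open_dense_sub_closed _ _ _ _ Mdense oU clB) => x [Ux Mx].
exact: (UB (exist _ x Mx)).
Qed.
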